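(* Let $$\Omega_{\mathrm r}=\Bigl\{Q\in\mathbb{R}_+^{m\times k}:\sum_{j=1}^kQ_{ij}=1,\ i=1,\dots,m\Bigr\}.$$ Consider the closed-loop system, for $t\in\mathbb{Z}_+$, $$X_{t+1}=\mathcal{A}(X_t)+\mathcal{B}\bigl(\Theta\Psi(X_t,t)+U_t\bigr),\qquad U_t=-\mathcal{K}(X_t)-\widehat{\Theta}_t\Psi(X_t,t)+U_t^{\mathrm d},$$ with arbitrary initial state $X_0\in\mathbb{R}^{n_1\times n_2}$, where $\widehat\Theta_0=\mathbf{1}_{m\times k}/k$ ($\mathbf 1_{m\times k}$ being the all-ones matrix) and $$\widehat{\Theta}_{t+1}=\mathcal{N}_{\mathrm r}\Bigl(\widehat{\Theta}_t\odot\exp_{\mathrm{el}}\bigl(-\eta_{t+1}\nabla J_t(\widehat{\Theta}_t)\bigr)\Bigr),\qquad \eta_{t+1}=\frac2m\,\frac{J_t(\widehat{\Theta}_t)}{\epsilon_{t+1}+\|\nabla J_t(\widehat{\Theta}_t)\|_\infty^2},$$ for a nonnegative bounded sequence $\{\epsilon_{t+1}\}_{t\in\mathbb{Z}_+}$. Suppose that $\Theta\in\Omega_{\mathrm r}$. Then for every integer $T\ge1$ the regret $\operatorname{Reg}(T):=\sum_{t=0}^{T-1}J_t(\widehat\Theta_t)$ satisfies $$\operatorname{Reg}(T)\le\sqrt{\frac{m^2\ln(k)}2\sum_{t=0}^{T-1}\left(\epsilon_{t+1}+\|\nabla J_t(\widehat\Theta_t)\|_\infty^2\right)} .$$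
   Context: Fix positive integers $n_1,n_2,m,k$. Matrix spaces carry the Frobenius inner product $\langle X,Y\rangle=\operatorname{Tr}(X^\top Y)$ and Frobenius norm $\|\cdot\|_{\mathrm F}$. $\mathcal{A}:\mathbb{R}^{n_1\times n_2}\to\mathbb{R}^{n_1\times n_2}$, $\mathcal{B}:\mathbb{R}^{m\times n_2}\to\mathbb{R}^{n_1\times n_2}$ and $\mathcal{K}:\mathbb{R}^{n_1\times n_2}\to\mathbb{R}^{m\times n_2}$ are linear operators such that $\mathcal{A}-\mathcal{B}\mathcal{K}$ (i.e. $X\mapsto\mathcal{A}(X)-\mathcal{B}(\mathcal{K}(X))$) is Schur stable (spectral radius $<1$). $\mathcal{B}^\top$ is the adjoint of $\mathcal{B}$: $\langle\mathcal{B}(U),V\rangle=\langle U,\mathcal{B}^\top(V)\rangle$. $\Psi:\mathbb{R}^{n_1\times n_2}\times\mathbb{Z}_+\to\mathbb{R}^{k\times n_2}$ is a map (the regressor), $\{U_t^{\mathrm d}\}_{t\in\mathbb{Z}_+}\subset\mathbb{R}^{m\times n_2}$ is a bounded sequence, and $\Theta$ is the fixed true parameter. Residual, loss and gradient: $$\widetilde X_{t+1}:=X_{t+1}-(\mathcal{A}-\mathcal{B}\mathcal{K})(X_t)-\mathcal{B}(U_t^{\mathrm d})=\mathcal{B}\bigl((\Theta-\widehat\Theta_t)\Psi(X_t,t)\bigr),$$ $$J_t(\widehat\Theta_t):=\tfrac12\bigl\|\mathcal{B}\bigl((\Theta-\widehat\Theta_t)\Psi(X_t,t)\bigr)\bigr\|_{\mathrm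 F}^2=\tfrac12\|\widetilde X_{t+1}\|_{\mathrm F}^2,\qquad \nabla J_t(\widehat\Theta_t)=-\mathcal{B}^\top(\widetilde X_{t+1})\Psi(X_t,t)^\top .$$ $\|Q\|_\infty=\max_{i,j}|Q_{ij}|$, $\exp_{\mathrm{el}}$ is the entrywise exponential, $\odot$ is the Hadamard product, $\mathbb{R}_+^{m\times k}$ is the set of matrices with nonnegative entries, and $\mathcal{N}_{\mathrm r}$ denotes row-wise normalization: $(\mathcal{N}_{\mathrm r}(Q))_{ij}=Q_{ij}/\sum_{l=1}^kQ_{il}$. Convention: if the denominator in the step size is zero (in which case $J_t(\widehat\Theta_t)=0$ too), set $\eta_{t+1}=0$. *)

(* Defs.v *)
From HB Require Import structures.
From mathcomp Require Import all_boot all_order all_algebra.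
From mathcomp Require Import all_classical all_reals all_analysis.
From mathcomp Require Import complex.
From mathcomp Require Import ring.

Set Implicit Arguments.
Unset Strict Implicit.
Unset Printing Implicit Defensive.

Import Order.TTheory GRing.Theory Num.Theory.
Import numFieldNormedType.Exports.

Local Open Scope classical_set_scope.
Local Open Scope ring_scope.

Definition frob_dot (R : realType) (p q : nat) (X Y : 'M[R]_(p, q)) : R :=
  \tr (X^T *m Y).

Definition frob_norm (R : realType) (p q : nat) (X : 'M[R]_(p, q)) : R :=
  Num.sqrt (frob_dot X X).

(* [lin_mx L] represents [L] on vectorized matrices; its eigenvalues are taken
   in the complex field [R[i]].  The set below is finite, and it is nonempty
   as soon as [p] and [q] are positive, so that [sup] is then a maximum. *)
Definition spectral_radius (R : realType) (p q : nat)
    (L : 'M[R]_(p, q) -> 'M[R]_(p, q)) : R :=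
  sup [set Normc.normc z | z in
    [set z : R[i] | eigenvalue (map_mx (real_complex R) (lin_mx L)) z]].

Definition schur_stable (R : realType) (p q : nat)
    (L : 'M[R]_(p, q) -> 'M[R]_(p, q)) : Prop :=
  spectral_radius L < 1.

Definition loss (R : realType) (n1 n2 m k : nat)
    (B : 'M[R]_(m, n2) -> 'M[R]_(n1, n2)) (Theta : 'M[R]_(m, k))
    (Psi : 'M[R]_(k, n2)) (Q : 'M[R]_(m, k)) : R :=
  2^-1 * frob_norm (B ((Theta - Q) *m Psi)) ^+ 2.

(* Gradient with respect to the Frobenius inner product: the matrix of the
   partial derivatives.  For [loss], see [gradient_loss] below. *)
Definition gradient (R : realType) (p q : nat) (F : 'M[R]_(p, q) -> R)
    (Q : 'M[R]_(p, q)) : 'M[R]_(p, q) :=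
  \matrix_(i, j) 'D_(delta_mx i j) (F : 'M[R]_(p, q) -> R^o) Q.

Definition max_norm (R : realType) (p q : nat) (Q : 'M[R]_(p, q)) : R :=
  \big[Num.max/0]_(ij : 'I_p * 'I_q) `|Q ij.1 ij.2|.

Definition exp_el (R : realType) (p q : nat) (Q : 'M[R]_(p, q)) :
  'M[R]_(p, q) := map_mx expR Q.

Definition hadamard (R : realType) (p q : nat) (P Q : 'M[R]_(p, q)) :
  'M[R]_(p, q) := \matrix_(i, j) (P i j * Q i j).

Definition row_normalize (R : realType) (p q : nat) (Q : 'M[R]_(p, q)) :
  'M[R]_(p, q) := \matrix_(i, j) (Q i j / \sum_l Q i l).

Definition Omega_r (R : realType) (m k : nat) : set 'M[R]_(m, k) :=
  [set Q | (forall i j, 0 <= Q i j) /\ (forall i, \sum_j Q i j = 1)].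

Definition step_size (R : realType) (m k : nat) (e J : R)
    (G : 'M[R]_(m, k)) : R :=
  if e + max_norm G ^+ 2 == 0 then 0
  else 2 / m%:R * (J / (e + max_norm G ^+ 2)).

Definition is_adjoint (R : realType) (p q r s : nat)
    (B : 'M[R]_(p, q) -> 'M[R]_(r, s)) (Bt : 'M[R]_(r, s) -> 'M[R]_(p, q)) :
  Prop := forall U V, frob_dot (B U) V = frob_dot U (Bt V).

Lemma frob_dotE (R : realType) (p q : nat) (X Y : 'M[R]_(p, q)) :
  frob_dot X Y = \sum_i \sum_j X i j * Y i j.
Proof.
rewrite /frob_dot /mxtrace exchange_big; apply: eq_bigr => j _.
by rewrite mxE; apply: eq_bigr => i _; rewrite mxE.
Qed.

Lemma frob_norm_sqr (R : realType) (p q : nat) (X : 'M[R]_(p, q)) :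
  frob_norm X ^+ 2 = frob_dot X X.
Proof.
rewrite sqr_sqrtr // frob_dotE sumr_ge0 // => i _.
by rewrite sumr_ge0 // => j _; rewrite -expr2 sqr_ge0.
Qed.

Lemma gradient_loss (R : realType) (n1 n2 m k : nat)
    (B : {linear 'M[R]_(m, n2) -> 'M[R]_(n1, n2)})
    (Bt : 'M[R]_(n1, n2) -> 'M[R]_(m, n2))
    (Theta : 'M[R]_(m, k)) (Psi : 'M[R]_(k, n2)) (Q : 'M[R]_(m, k)) :
  is_adjoint B Bt ->
  gradient (loss B Theta Psi) Q =
  - (Bt (B ((Theta - Q) *m Psi)) *m Psi^T).
Proof.
move=> BtP; apply/matrixP => i j; rewrite !mxE.
set Y := B ((Theta - Q) *m Psi).
set E : 'M[R]_(m, k) := delta_mx i j; set Z := B (E *m Psi).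
have dotC (X W : 'M[R]_(n1, n2)) : frob_dot X W = frob_dot W X.
  by rewrite /frob_dot -mxtrace_tr trmx_mul trmxK.
have lossE h : loss B Theta Psi (h *: E + Q) =
    2^-1 * frob_dot Y Y - h * frob_dot Z Y + h ^+ 2 * (2^-1 * frob_dot Z Z).
  rewrite /loss frob_norm_sqr.
  have -> : B ((Theta - (h *: E + Q)) *m Psi) = Y - h *: Z.
    rewrite /Y /Z -linearZ -linearB /= scalemxAl -mulmxBl; congr (B (_ *m _)).
    by rewrite opprD addrA addrAC.
  have dotBr V W1 W2 : frob_dot V (W1 - h *: W2) =
      frob_dot V W1 - h * frob_dot V W2.
    by rewrite /frob_dot mulmxBr -scalemxAr raddfB /= mxtraceZ.
  rewrite dotBr ![frob_dot (Y - _) _]dotC !dotBr (dotC Y Z).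
  by field.
have dotZ : frob_dot Z Y = \sum_l Bt Y i l * Psi^T l j.
  rewrite BtP frob_dotE (bigD1 i) //= [X in _ + X]big1 ?addr0 => [|i' ne].
    apply: eq_bigr => l _; rewrite mulrC !mxE (bigD1 j) //= !mxE !eqxx mul1r.
    by rewrite big1 ?addr0 // => j' /negPf ne; rewrite mxE ne andbF mul0r.
  apply: big1 => l _; rewrite mxE big1 ?mul0r // => j' _.
  by rewrite mxE (negPf ne) mul0r.
rewrite -dotZ; apply/cvg_lim => //.
have lim0 : - frob_dot Z Y + h * (2^-1 * frob_dot Z Z) @[h --> (0:R)^'] -->
    - frob_dot Z Y.
  rewrite -[X in _ --> X]addr0 -[X in _ --> _ + X](mul0r (2^-1 * frob_dot Z Z)).
  apply: cvgD; first exact: cvg_cst.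
  by apply: cvgMl; apply: cvg_within_filter; apply: cvg_id.
apply: cvg_trans lim0; apply: near_eq_cvg; near=> h.
have h0 : h != 0 by near: h; exact: nbhs_dnbhs_neq.
have := lossE 0; rewrite scale0r add0r /= => ->; rewrite lossE.
rewrite /GRing.scale /=.
by field.
Unshelve. all: by end_near. Qed.

(* Main.v *)
Require Import Defs.
From HB Require Import structures.
From mathcomp Require Import all_boot all_order all_algebra.
From mathcomp Require Import all_classical all_reals all_analysis.
From mathcomp Require Import ring lra.

Set Implicit Arguments.
Unset Strict Implicit.
Unset Printing Implicit Defensive.

Import Order.TTheory GRing.Theory Num.Theory.
Import numFieldNormedType.Exports.

Local Open Scope classical_set_scope.
Local Open Scope ring_scope.

(** The update is the exponentiated-gradient (multiplicative weights) method,
    run independently on each row of the estimate but with a common step size.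
    Its natural potential is the cross entropy
      W_t = - sum_(i, j) Theta_ij ln (That_t)_ij ,
    which differs from the row-wise Kullback-Leibler divergence from Theta to
    That_t by a constant.  It is nonnegative because the entries of That_t are
    at most 1, and it equals m ln k at the uniform initial estimate.

    One update changes W_t by eta <Theta, G> + sum_i ln Z_i, where G is the
    gradient and Z_i is the normalizing constant of row i, that is, the moment
    generating function of -eta G_ij for j drawn from row i of That_t.
    Hoeffding's lemma bounds ln Z_i by the mean plus (eta |G|_oo)^2 / 2, so
      W_(t+1) <= W_t - eta <That_t - Theta, G> + m (eta |G|_oo)^2 / 2
    ([potential_eg_update]).  The loss is a quadratic form in That_t - Theta,
    whence <That_t - Theta, G> = 2 J_t exactly ([frob_dot_gradient_loss]).
    With D_t = eps_(t+1) + |G|_oo^2, the step size eta = (2 / m) J_t / D_t is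
    the minimizer over eta of the upper bound -2 eta J_t + m eta^2 D_t / 2, and
    the decrease is at least (2 / m) J_t^2 / D_t ([potential_step]).
    Telescoping gives sum_t J_t^2 / D_t <= m^2 ln k / 2, and the
    Cauchy-Schwarz inequality ([sum_le_sqrt]) turns this into the bound on
    sum_t J_t. *)

(** * Hoeffding's lemma *)

Lemma le_of_derive_ge0 (R : realType) (f df : R -> R) (c : R) : 0 <= c ->
  (forall x : R, is_derive x 1 f (df x)) -> (forall x, 0 <= x -> 0 <= df x) ->
  f 0 <= f c.
Proof.
move=> c0 fD df0.
have [|x xc] := MVT_segment c0 (fun x _ => fD x).
  by apply: derivable_within_continuous => x _; apply: ex_derive.
rewrite subr0 -[leLHS]addr0 -lerBDl => ->.
by rewrite mulr_ge0// df0//; move: xc; rewrite in_itv/= => /andP[].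
Qed.

(** The difference between the exponent and the logarithm of
    w(x) = a e^x + b e^(-x) vanishes at 0 and has derivative
    u = (a - b) + x - w'/w.  As w'' = w, u has derivative
    1 - (1 - (w'/w)^2) = (w'/w)^2 >= 0, and u vanishes at 0 too; two
    applications of the mean value theorem conclude. *)
Lemma hoeffding_two_points (R : realType) (a b c : R) :
  0 <= a -> 0 <= b -> a + b = 1 -> 0 <= c ->
  a * expR c + b * expR (- c) <= expR ((a - b) * c + c ^+ 2 / 2).
Proof.
move=> a0 b0 ab1 c0.
pose w : R -> R := a \*: expR + b \*: (expR \o -%R).
pose v : R -> R := a \*: expR - b \*: (expR \o -%R).
have wE x : w x = a * expR x + b * expR (- x) by [].
have vE x : v x = a * expR x - b * expR (- x) by [].
have w_gt0 x : 0 < w x.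
  rewrite wE; have [a_gt0|ale0] := ltP 0 a.
    by rewrite ltr_pwDl ?mulr_gt0 ?mulr_ge0 ?expR_ge0 ?expR_gt0.
  have b_gt0 : 0 < b by lra.
  by rewrite ltr_wpDl ?mulr_gt0 ?mulr_ge0 ?expR_ge0 ?expR_gt0.
have eD (x : R) : is_derive x 1 (expR \o -%R : R -> R) (expR (- x) * -1).
  exact: is_derive1_comp.
have wD (x : R) : is_derive x 1 w (v x).
  apply: is_derive_eq; rewrite vE /GRing.scale /=; ring.
have vD (x : R) : is_derive x 1 v (w x).
  apply: is_derive_eq; rewrite wE /GRing.scale /=; ring.
(* Opaque names keep the search for derivatives below from unfolding [w] and
   [v]. *)
clearbody w v.
pose u : R -> R := cst (a - b) + id - v * (fun x => (w x)^-1).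
have uE x : u x = (a - b) + x - v x / w x by [].
have uD (x : R) : is_derive x 1 u ((v x / w x) ^+ 2).
  have wx := lt0r_neq0 (w_gt0 x); have iD := is_deriveV wx (wD x).
  apply: is_derive_eq; rewrite /GRing.scale /=; field.
  exact: wx.
have w0 : w 0 = 1 by rewrite wE oppr0 expR0 !mulr1.
have u_ge0 x : 0 <= x -> 0 <= u x.
  move=> x0.
  have u0 : u 0 = 0.
    by rewrite uE w0 vE oppr0 expR0 !mulr1 divr1 addr0 subrr.
  rewrite -u0; apply: (le_of_derive_ge0 x0 uD) => y _; exact: sqr_ge0.
clearbody u.
pose f : R -> R := (a - b) \*: id + 2^-1 \*: (id ^+ 2) - ((@ln R) \o w).
have fE x : f x = (a - b) * x + x ^+ 2 / 2 - ln (w x).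
  by rewrite [x ^+ 2 / 2]mulrC /f exprfctE.
have fD (x : R) : is_derive x 1 f (u x).
  have lnD := is_derive1_comp (is_derive1_ln (w_gt0 x)) (wD x).
  apply: is_derive_eq; rewrite uE /GRing.scale /=; field.
  exact: lt0r_neq0.
have := le_of_derive_ge0 c0 fD u_ge0.
rewrite !fE w0 ln1 mulr0 expr0n/= mul0r addr0 subr0 subr_ge0.
by rewrite -ler_expR lnK ?wE// posrE -wE.
Qed.

(** On [-c, c] the exponential lies below its chord, so the two-point law on
    {-c, c} with the same mean has the larger exponential moment: this reduces
    the claim to [hoeffding_two_points]. *)
Lemma hoeffding (R : realType) (I : finType) (p x : I -> R) (c : R) :
  (forall i, 0 <= p i) -> \sum_i p i = 1 -> (forall i, `|x i| <= c) ->
  \sum_i p i * expR (x i) <= expR (\sum_i p i * x i + c ^+ 2 / 2).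
Proof.
move=> p0 p1 xc.
have [c_gt0|c_le0] := ltP 0 c; last first.
  have x0 i : x i = 0.
    by apply/eqP; rewrite -normr_le0 (le_trans (xc i)).
  rewrite (eq_bigr p) => [|i _]; last by rewrite x0 expR0 mulr1.
  rewrite p1 [X in X + _]big1 => [|i _]; last by rewrite x0 mulr0.
  by rewrite add0r -[leLHS]expR0 ler_expR divr_ge0 ?sqr_ge0.
have c0 : c != 0 by exact: lt0r_neq0.
(* [l i] is the weight of [c] when [x i] is written as a convex combination
   of [c] and [- c]. *)
pose l i := (x i + c) / (2 * c).
have xb i : - c <= x i <= c by rewrite -ler_norml.
have l0 i : 0 <= l i.
  rewrite divr_ge0 ?mulr_ge0 ?(ltW c_gt0)// -lerBlDr sub0r.
  by case/andP: (xb i).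
have l1 i : l i <= 1.
  by case/andP: (xb i) => _ h; rewrite ler_pdivrMr ?mulr_gt0// mul1r; lra.
have chord i : expR (x i) <= l i * expR c + (1 - l i) * expR (- c).
  have xE : x i = l i * c + (1 - l i) * - c by rewrite /l; field.
  rewrite {1}xE; have := convex_expR (Itv01 (l0 i) (l1 i)) c (- c).
  by rewrite !convRE.
pose a := \sum_i p i * l i.
have bE : \sum_i p i * (1 - l i) = 1 - a.
  by under eq_bigr do rewrite mulrBr mulr1; rewrite sumrB p1.
have b0 : 0 <= 1 - a.
  by rewrite -bE sumr_ge0// => i _; rewrite mulr_ge0// subr_ge0.
have mean : \sum_i p i * x i = (a - (1 - a)) * c.
  rewrite -bE /a -sumrB mulr_suml; apply: eq_bigr => i _.
  by rewrite /l; field.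
have a0 : 0 <= a by rewrite sumr_ge0// => i _; rewrite mulr_ge0.
rewrite mean.
apply: le_trans (hoeffding_two_points a0 b0 (subrKC _ _) (ltW c_gt0)).
rewrite -bE /a !mulr_suml -big_split/=; apply: ler_sum => i _.
by rewrite -2!(mulrA (p i)) -mulrDr ler_wpM2l.
Qed.

(** * Exponential weights on the simplex *)

Definition cross_entropy (R : realType) (I : finType) (q p : I -> R) : R :=
  - \sum_i q i * ln (p i).

Lemma cross_entropy_ge0 (R : realType) (I : finType) (q p : I -> R) :
  (forall i, 0 <= q i) -> (forall i, 0 < p i) -> \sum_i p i = 1 ->
  0 <= cross_entropy q p.
Proof.
move=> q0 p0 p1; rewrite /cross_entropy -sumrN sumr_ge0// => i _.
rewrite -mulrN mulr_ge0// oppr_ge0 ln_le0// -p1 (bigD1 i)//= lerDl.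
by rewrite sumr_ge0// => j _; exact: ltW.
Qed.

Lemma cross_entropy_uniform (R : realType) (k : nat) (q : 'I_k -> R) :
  \sum_i q i = 1 -> cross_entropy q (fun=> 1 / k%:R) = ln k%:R.
Proof.
case: k q => [|k] q q1.
  by move: q1 (oner_neq0 R); rewrite big_ord0 => ->; rewrite eqxx.
by rewrite /cross_entropy -mulr_suml q1 mul1r div1r lnV ?posrE ?ltr0n ?opprK.
Qed.

(** The change of the cross entropy is eta * sum_i q_i g_i + ln Z, where the
    normalizing constant Z is the exponential moment of -eta g under p. *)
Lemma cross_entropy_exp_weights (R : realType) (I : finType)
    (q p g : I -> R) (eta G : R) :
  (forall i, 0 <= q i) -> \sum_i q i = 1 ->
  (forall i, 0 < p i) -> \sum_i p i = 1 ->
  0 <= eta -> (forall i, `|g i| <= G) ->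
  cross_entropy q (fun i => p i * expR (- eta * g i) /
                            \sum_j p j * expR (- eta * g j)) <=
  cross_entropy q p - eta * \sum_i (p i - q i) * g i + (eta * G) ^+ 2 / 2.
Proof.
move=> q0 q1 p0 p1 eta0 gG; set Z := \sum_j _.
have Z0 : 0 < Z.
  rewrite lt0r sumr_ge0 ?andbT => [|i _]; last first.
    by rewrite mulr_ge0 ?expR_ge0 ?ltW.
  apply: contra_eq_neq q1 => /eqP; rewrite psumr_eq0 => [/allP Z0|i _].
    rewrite big1 1?eq_sym ?oner_neq0// => i _.
    have := Z0 i (mem_index_enum i).
    by rewrite mulf_eq0 expR_eq0 orbF gt_eqF.
  by rewrite mulr_ge0 ?expR_ge0 ?ltW.
have lnZ : ln Z <= - eta * (\sum_i p i * g i) + (eta * G) ^+ 2 / 2.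
  rewrite -ler_expR lnK ?posrE// mulr_sumr.
  under [X in _ <= expR (X + _)]eq_bigr do rewrite mulrCA.
  apply: hoeffding => // i; first exact: ltW.
  by rewrite normrM normrN (ger0_norm eta0) ler_wpM2l.
have -> : cross_entropy q (fun i => p i * expR (- eta * g i) / Z) =
    cross_entropy q p + eta * (\sum_i q i * g i) + ln Z.
  rewrite /cross_entropy -[ln Z]mul1r -q1 mulr_suml mulr_sumr -!sumrN.
  rewrite -!big_split/=; apply: eq_bigr => i _.
  rewrite ln_div ?posrE ?mulr_gt0 ?expR_gt0// lnM ?posrE ?expR_gt0// expRK.
  by ring.
have -> : \sum_i (p i - q i) * g i = \sum_i p i * g i - \sum_i q i * g i.
  by rewrite -sumrB; apply: eq_bigr => i _; rewrite mulrBl.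
by rewrite mulrBr; lra.
Qed.

(** * The Cauchy-Schwarz step *)

(** The form sum J <= sqrt (sum J^2 / D) * sqrt (sum D) of the Cauchy-Schwarz
    inequality.  A zero denominator contributes J^2 / 0 = 0 to the sum
    of the J^2 / D, which is harmless because J vanishes there. *)
Lemma sum_le_sqrt (R : realType) (J D : nat -> R) (T : nat) (C : R) :
  (forall t, 0 <= J t) -> (forall t, 0 <= D t) ->
  (forall t, D t = 0 -> J t = 0) ->
  \sum_(0 <= t < T) J t ^+ 2 / D t <= C ->
  \sum_(0 <= t < T) J t <= Num.sqrt (C * \sum_(0 <= t < T) D t).
Proof.
move=> J0 D0 DJ JDC; set S := \sum_(0 <= t < T) D t.
(* Rearranged expansion of (J - l D)^2 / D >= 0; summed over t, the best
   choice is l = (sum J) / (sum D). *)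
have tangent (l : R) t : 2 * l * J t - l ^+ 2 * D t <= J t ^+ 2 / D t.
  have [Dt|Dt] := eqVneq (D t) 0.
    by rewrite Dt DJ// invr0 !mulr0 subr0.
  have Dt0 : 0 < D t by rewrite lt0r Dt D0.
  rewrite ler_pdivlMr// -subr_ge0.
  have -> : J t ^+ 2 - (2 * l * J t - l ^+ 2 * D t) * D t =
    (J t - l * D t) ^+ 2 by ring.
  exact: sqr_ge0.
have bound (l : R) : 2 * l * (\sum_(0 <= t < T) J t) - l ^+ 2 * S <= C.
  rewrite !mulr_sumr -sumrB; apply: le_trans JDC.
  by apply: ler_sum => t _; exact: tangent.
have S0 : 0 <= S by apply: sumr_ge0 => t _.
have [SE|SN] := eqVneq S 0.
  suff -> : \sum_(0 <= t < T) J t = 0 by exact: sqrtr_ge0.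
  rewrite big_nat big1// => t tT; apply: DJ.
  move/eqP: SE; rewrite psumr_eq0// => /allP/(_ t).
  by rewrite mem_index_iota => /(_ tT)/eqP.
have S_gt0 : 0 < S by rewrite lt0r SN.
rewrite -[leLHS]ger0_norm ?sumr_ge0// -sqrtr_sqr ler_wsqrtr//.
set s := \sum_(0 <= t < T) J t in bound *.
rewrite -ler_pdivrMr//.
have -> : s ^+ 2 / S = 2 * (s / S) * s - (s / S) ^+ 2 * S by field.
exact: bound.
Qed.

(** * The gradient of the loss *)

Lemma adjoint_exists (R : realType) (p q r s : nat)
    (B : {linear 'M[R]_(p, q) -> 'M[R]_(r, s)}) :
  exists Bt : 'M[R]_(r, s) -> 'M[R]_(p, q), is_adjoint B Bt.
Proof.
exists (fun V => \matrix_(i, j) frob_dot (B (delta_mx i j)) V) => U V.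
rewrite {1}(matrix_sum_delta U) linear_sum /frob_dot !raddf_sum/=.
rewrite mulmx_suml raddf_sum -/(frob_dot _ _) frob_dotE.
apply: eq_bigr => i _; rewrite linear_sum raddf_sum mulmx_suml raddf_sum/=.
apply: eq_bigr => j _.
by rewrite linearZ/= linearZ/= -scalemxAl mxtraceZ mxE.
Qed.

(** Euler's identity for the loss, which is homogeneous of degree 2 in
    Q - Theta. *)
Lemma frob_dot_gradient_loss (R : realType) (n1 n2 m k : nat)
    (B : {linear 'M[R]_(m, n2) -> 'M[R]_(n1, n2)})
    (Theta : 'M[R]_(m, k)) (Psi : 'M[R]_(k, n2)) (Q : 'M[R]_(m, k)) :
  frob_dot (Q - Theta) (gradient (loss B Theta Psi) Q) =
  2 * loss B Theta Psi Q.
Proof.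
have [Bt BtP] := adjoint_exists B; rewrite (gradient_loss _ _ _ BtP).
set Y := B _; rewrite /loss frob_norm_sqr mulVKf ?pnatr_eq0// BtP -/Y.
rewrite /frob_dot -[Q - Theta]opprB [X in X *m _]linearN/= mulNmx mulmxN opprK.
by rewrite mulmxA mxtrace_mulC mulmxA -trmx_mul.
Qed.

Lemma loss_ge0 (R : realType) (n1 n2 m k : nat)
    (B : 'M[R]_(m, n2) -> 'M[R]_(n1, n2)) (Theta : 'M[R]_(m, k))
    (Psi : 'M[R]_(k, n2)) (Q : 'M[R]_(m, k)) : 0 <= loss B Theta Psi Q.
Proof. by rewrite mulr_ge0 ?invr_ge0 ?sqr_ge0. Qed.

Lemma le_max_norm (R : realType) (p q : nat) (G : 'M[R]_(p, q)) i j :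
  `|G i j| <= max_norm G.
Proof. exact: (le_bigmax _ (fun ij => `|G ij.1 ij.2|) (i, j)). Qed.

Lemma frob_dot_max_norm0 (R : realType) (p q : nat) (D G : 'M[R]_(p, q)) :
  max_norm G = 0 -> frob_dot D G = 0.
Proof.
move=> G0; rewrite frob_dotE big1// => i _; rewrite big1// => j _.
have := le_max_norm G i j; rewrite G0 normr_le0 => /eqP ->.
by rewrite mulr0.
Qed.

(** * One step of the exponentiated gradient method *)

Lemma step_size_ge0 (R : realType) (m k : nat) (e J : R) (G : 'M[R]_(m, k)) :
  0 <= e -> 0 <= J -> 0 <= step_size e J G.
Proof.
move=> e0 J0; rewrite /step_size; case: ifP => // _.
by rewrite mulr_ge0 ?divr_ge0 ?addr_ge0 ?sqr_ge0.
Qed.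

(** Strict positivity, which fails on the boundary of the set of stochastic
    matrices, makes the logarithms in the potential meaningful. *)
Definition positive_stochastic (R : realType) (m k : nat) (P : 'M[R]_(m, k)) :
  Prop := (forall i j, 0 < P i j) /\ (forall i, \sum_j P i j = 1).

Definition eg_update (R : realType) (m k : nat) (P : 'M[R]_(m, k)) (eta : R)
    (G : 'M[R]_(m, k)) : 'M[R]_(m, k) :=
  row_normalize (hadamard P (exp_el (- eta *: G))).

Lemma eg_updateE (R : realType) (m k : nat) (P G : 'M[R]_(m, k)) (eta : R) i j :
  eg_update P eta G i j = P i j * expR (- eta * G i j) /
    \sum_l P i l * expR (- eta * G i l).
Proof. by rewrite !mxE; congr (_ / _); apply: eq_bigr => l _; rewrite !mxE. Qed.

Lemma positive_stochastic_uniform (R : realType) (m k : nat) : (0 < k)%N ->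
  positive_stochastic (const_mx (1 / k%:R) : 'M[R]_(m, k)).
Proof.
move=> k0; split=> [i j|i]; first by rewrite mxE divr_gt0 ?ltr0n.
under eq_bigr do rewrite mxE.
by rewrite sumr_const card_ord -[LHS]mulr_natr mul1r mulVf// pnatr_eq0 -lt0n.
Qed.

Lemma positive_stochastic_eg_update (R : realType) (m k : nat)
    (P G : 'M[R]_(m, k)) (eta : R) : (0 < k)%N ->
  positive_stochastic P -> positive_stochastic (eg_update P eta G).
Proof.
move=> k0 [P0 P1].
have Z0 i : 0 < \sum_l P i l * expR (- eta * G i l).
  rewrite (bigD1 (Ordinal k0))//= ltr_pwDl ?mulr_gt0 ?expR_gt0//.
  by rewrite sumr_ge0// => l _; rewrite mulr_ge0 ?expR_ge0 ?ltW.
split=> [i j|i]; first by rewrite eg_updateE divr_gt0 ?mulr_gt0 ?expR_gt0.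
under eq_bigr do rewrite eg_updateE.
by rewrite -mulr_suml divff// lt0r_neq0.
Qed.

Definition potential (R : realType) (m k : nat) (Theta P : 'M[R]_(m, k)) : R :=
  \sum_i cross_entropy (Theta i) (P i).

(** The sum of [cross_entropy_exp_weights] over the rows; the factor m counts
    them, each gradient row being bounded by the same maximum norm. *)
Lemma potential_eg_update (R : realType) (m k : nat)
    (Theta P G : 'M[R]_(m, k)) (eta : R) :
  Omega_r Theta -> positive_stochastic P -> 0 <= eta ->
  potential Theta (eg_update P eta G) <=
  potential Theta P - eta * frob_dot (P - Theta) G +
  m%:R * ((eta * max_norm G) ^+ 2 / 2).
Proof.
move=> [Th0 Th1] [P0 P1] eta0.
have -> : m%:R * ((eta * max_norm G) ^+ 2 / 2) =
    \sum_(i < m) (eta * max_norm G) ^+ 2 / 2.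
  by rewrite sumr_const card_ord mulr_natl.
rewrite frob_dotE mulr_sumr /potential -sumrB -big_split/=.
apply: ler_sum => i _.
under eq_bigr do rewrite 2!mxE.
apply: le_trans (cross_entropy_exp_weights _ _ _ _ eta0 _) => //.
  rewrite /cross_entropy lerN2 le_eqVlt; apply/orP; left; apply/eqP.
  by apply: eq_bigr => j _; rewrite eg_updateE.
by move=> j; exact: le_max_norm.
Qed.

(** The first-order gain -2 eta J is twice the bound m eta^2 D / 2 on the
    quadratic loss for the chosen step size.  When the denominator of the step
    size is 0, the estimate is left where it is and the claimed decrease,
    J^2 / 0, is 0. *)
Lemma potential_step (R : realType) (n1 n2 m k : nat)
    (B : {linear 'M[R]_(m, n2) -> 'M[R]_(n1, n2)})
    (Theta : 'M[R]_(m, k)) (Psi : 'M[R]_(k, n2)) (P G : 'M[R]_(m, k))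
    (e J : R) :
  (0 < m)%N -> 0 <= e -> Omega_r Theta -> positive_stochastic P ->
  J = loss B Theta Psi P -> G = gradient (loss B Theta Psi) P ->
  2 / m%:R * (J ^+ 2 / (e + max_norm G ^+ 2)) +
    potential Theta (eg_update P (step_size e J G) G) <=
  potential Theta P.
Proof.
move=> m0 e0 ThO PP JE GE; set D := e + _.
have J0 : 0 <= J by rewrite JE loss_ge0.
have := potential_eg_update G ThO PP (step_size_ge0 G e0 J0).
have dotJ : frob_dot (P - Theta) G = 2 * J.
  by rewrite GE frob_dot_gradient_loss -JE.
rewrite dotJ.
set W := potential Theta P; set W' := potential Theta _.
set eta := step_size _ _ _.
have [DE|DN] := eqVneq D 0.
  have -> : eta = 0 by rewrite /eta /step_size -/D DE eqxx.
  rewrite DE invr0 !mul0r !mulr0 expr0n/= mul0r mulr0.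
  by rewrite add0r subr0 addr0.
have D0 : 0 < D by rewrite lt0r DN addr_ge0 ?sqr_ge0.
have GD : max_norm G ^+ 2 <= D by rewrite lerDr.
have mN : m%:R != 0 :> R by rewrite pnatr_eq0 -lt0n.
have etaE : eta = 2 / m%:R * (J / D).
  by rewrite /eta /step_size -/D (negPf DN).
move=> WW; rewrite addrC -lerBrDr; apply: le_trans WW _.
rewrite -addrA lerD2l exprMn etaE.
have c0 : 0 <= m%:R * ((2 / m%:R * (J / D)) ^+ 2 / 2).
  by rewrite mulr_ge0 ?divr_ge0 ?sqr_ge0.
have := ler_wpM2l c0 GD.
have -> : m%:R * ((2 / m%:R * (J / D)) ^+ 2 / 2) * D =
  2 / m%:R * (J ^+ 2 / D) by field; rewrite ?mN ?DN.
have -> : m%:R * ((2 / m%:R * (J / D)) ^+ 2 / 2) * max_norm G ^+ 2 =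
  m%:R * ((2 / m%:R * (J / D)) ^+ 2 * max_norm G ^+ 2 / 2) by ring.
have -> : 2 / m%:R * (J / D) * (2 * J) = 2 * (2 / m%:R * (J ^+ 2 / D)).
  by field; rewrite ?mN ?DN.
by lra.
Qed.

(** * The regret bound *)

Theorem mainTheorem8 (R : realType) (n1 n2 m k : nat)
    (n1_gt0 : (0 < n1)%N) (n2_gt0 : (0 < n2)%N)
    (m_gt0 : (0 < m)%N) (k_gt0 : (0 < k)%N)
    (A : {linear 'M[R]_(n1, n2) -> 'M[R]_(n1, n2)})
    (B : {linear 'M[R]_(m, n2) -> 'M[R]_(n1, n2)})
    (K : {linear 'M[R]_(n1, n2) -> 'M[R]_(m, n2)})
    (ABK_stable : schur_stable (fun Y : 'M[R]_(n1, n2) => A Y - B (K Y)))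
    (Psi : 'M[R]_(n1, n2) -> nat -> 'M[R]_(k, n2))
    (Ud : nat -> 'M[R]_(m, n2))
    (Ud_bounded : exists M : R, forall t, frob_norm (Ud t) <= M)
    (eps : nat -> R)
    (eps_ge0 : forall t, 0 <= eps t.+1)
    (eps_bounded : exists M : R, forall t, eps t.+1 <= M)
    (Theta : 'M[R]_(m, k))
    (Theta_Omega : Omega_r Theta)
    (X : nat -> 'M[R]_(n1, n2)) (U : nat -> 'M[R]_(m, n2))
    (That : nat -> 'M[R]_(m, k)) (eta : nat -> R)
    (J : nat -> R) (gradJ : nat -> 'M[R]_(m, k))
    (X_rec : forall t, X t.+1 = A (X t) + B (Theta *m Psi (X t) t + U t))
    (U_def : forall t, U t = - K (X t) - That t *m Psi (X t) t + Ud t)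
    (J_def : forall t, J t = loss B Theta (Psi (X t) t) (That t))
    (gradJ_def : forall t,
       gradJ t = gradient (loss B Theta (Psi (X t) t)) (That t))
    (eta_def : forall t, eta t.+1 = step_size (eps t.+1) (J t) (gradJ t))
    (That_init : That 0%N = const_mx (1 / k%:R))
    (That_rec : forall t, That t.+1 =
       row_normalize (hadamard (That t) (exp_el (- eta t.+1 *: gradJ t))))
    (T : nat) (T_ge1 : (1 <= T)%N) :
  \sum_(0 <= t < T) J t <=
  Num.sqrt (m%:R ^+ 2 * ln (k%:R : R) / 2 *
            \sum_(0 <= t < T) (eps t.+1 + max_norm (gradJ t) ^+ 2)).
Proof.
have eg_rec t : That t.+1 = eg_update (That t)
    (step_size (eps t.+1) (J t) (gradJ t)) (gradJ t).
  by rewrite That_rec eta_def.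
have That_pos t : positive_stochastic (That t).
  elim: t => [|t IH].
    by rewrite That_init; exact: positive_stochastic_uniform.
  by rewrite eg_rec; exact: positive_stochastic_eg_update.
pose D t := eps t.+1 + max_norm (gradJ t) ^+ 2.
have J0 t : 0 <= J t by rewrite J_def; exact: loss_ge0.
have D0 t : 0 <= D t by rewrite addr_ge0 ?sqr_ge0.
have DJ t : D t = 0 -> J t = 0.
  move/eqP; rewrite paddr_eq0 ?sqr_ge0// sqrf_eq0 => /andP[_ /eqP G0].
  have := frob_dot_max_norm0 (That t - Theta) G0.
  rewrite gradJ_def frob_dot_gradient_loss -J_def => /eqP.
  by rewrite mulf_eq0 pnatr_eq0/= => /eqP.
(* Telescoped form of the one-step decrease. *)
have energy n : 2 / m%:R * (\sum_(0 <= t < n) J t ^+ 2 / D t) +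
    potential Theta (That n) <= potential Theta (That 0%N).
  elim: n => [|n IH]; first by rewrite big_geq// mulr0 add0r.
  apply: le_trans IH; rewrite big_nat_recr//= mulrDr -addrA lerD2l.
  by rewrite eg_rec; apply: potential_step => //; exact: gradJ_def.
case: Theta_Omega (Theta_Omega) => Th0 Th1 ThO.
have W0 : potential Theta (That 0%N) = m%:R * ln k%:R.
  rewrite /potential (eq_bigr (fun=> ln k%:R)) => [|i _].
    by rewrite sumr_const card_ord mulr_natl.
  rewrite -(cross_entropy_uniform (Th1 i)) /cross_entropy That_init.
  by under eq_bigr do rewrite mxE.
have WT : 0 <= potential Theta (That T).
  have [P0 P1] := That_pos T.
  by apply: sumr_ge0 => i _; exact: cross_entropy_ge0.
apply: sum_le_sqrt => //.
have m0 : 0 < m%:R :> R by rewrite ltr0n.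
have := energy T; rewrite W0 => h.
have {}h : 2 / m%:R * (\sum_(0 <= t < T) J t ^+ 2 / D t) <= m%:R * ln k%:R.
  by apply: le_trans h; rewrite lerDl.
have c0 : 0 <= m%:R / 2 :> R by rewrite divr_ge0.
have := ler_wpM2l c0 h.
have -> : m%:R / 2 * (m%:R * ln k%:R) = m%:R ^+ 2 * ln k%:R / 2 :> R by ring.
set S := \sum_(0 <= t < T) _.
have -> // : m%:R / 2 * (2 / m%:R * S) = S by field; exact: lt0r_neq0.
Qed.
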